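(* The following assertions are equivalent: (1) Every group grading on a Lie algebra is equivalent to an abelian group grading. (2) Every coarsening of an abelian group grading on a Lie algebra is equivalent to an abelian group grading.
   Context: Lie algebras are over a field $\mathbb{F}$. A group grading on an algebra $\mathcal{A}$ is, for some group $G$ (not necessarily abelian), a vector space decomposition $\Gamma:\mathcal{A}=\bigoplus_{g\in G}\mathcal{A}_g$ with $\mathcal{A}_g\mathcal{A}_h\subseteq\mathcal{A}_{gh}$ for all $g,h\in G$ (for a Lie algebra the product is the bracket). Its support is $\mathrm{Supp}\,\Gamma=\{g\in G\mid\mathcal{A}_g\neq0\}$. Two gradings $\Gamma:\mathcal{A}=\bigoplus_{g\in G}\mathcal{A}_g$ and $\Gamma':\mathcal{A}=\bigoplus_{h\in H}\mathcal{A}'_h$ on the same algebra are equivalent if there is an algebra automorphism $\psi$ of $\mathcal{A}$ such that for each $g\in\mathrm{Supp}\,\Gamma$ there is $h\in H$ with $\psi(\mathcal{A}_g)=\mathcal{A}'_h$. A grading $\Gamma$ is realized by a group $H$ if there exists an $H$-grading equivalent to $\Gamma$; $\Gamma$ is an abelian (group) grading if it is realized by an abelian group. $\Gamma$ is a coarsening of $\Gamma'$ (both group gradings on $\mathcal{A}$) if for every $h\in\mathrm{Supp}\,\Gamma'$ there is $g\in\mathrm{Supp}\,\Gamma$ such that $\mathcal{A}'_h\subseteq\mathcal{A}_g$. *)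

(* Defs.v *)
From HB Require Import structures.
From mathcomp Require Import all_boot all_order all_algebra.
From mathcomp Require Import boolp classical_sets.

Set Implicit Arguments.
Unset Strict Implicit.
Unset Printing Implicit Defensive.

Import GRing.Theory.

Local Open Scope classical_set_scope.
Local Open Scope ring_scope.

HB.mixin Record Lmodule_isLieAlgebra (F : fieldType) L & GRing.Lmodule F L := {
  lie : L -> L -> L;
  lie_linearl : forall y : L, linear (lie ^~ y);
  lie_linearr : forall x : L, linear (lie x);
  liexx : forall x : L, lie x x = 0;
  lie_jacobi : forall x y z : L,
    lie x (lie y z) + lie y (lie z x) + lie z (lie x y) = 0
}.

(* No finiteness assumption is made on the dimension. *)
#[short(type="lieAlgType")]
HB.structure Definition LieAlgebra (F : fieldType) :=
  {L of GRing.Lmodule F L & Lmodule_isLieAlgebra F L}.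

(* Since G and L may both be infinite, the decomposition of L as the internal  *)
(* direct sum of its components is expressed by finite sums over duplicate-    *)
(* free sequences of elements of G.                                            *)
Record grading (F : fieldType) (L : lieAlgType F) (G : groupType) := Grading {
  component :> G -> set L;
  component_submod : forall g, submod_closed [in component g];
  component_span : forall x : L, exists (s : seq G) (f : G -> L),
    [/\ uniq s, forall g, component g (f g) & x = \sum_(g <- s) f g];
  component_direct : forall (s : seq G) (f : G -> L),
    uniq s -> (forall g, component g (f g)) -> \sum_(g <- s) f g = 0 ->
    forall g, g \in s -> f g = 0;
  component_lie : forall (g h : G) (x y : L),
    component g x -> component h y -> component (g * h)%g (lie x y)
}.

Section GradingNotions.
Variables (F : fieldType) (L : lieAlgType F).

Definition Supp (G : groupType) (Gam : grading L G) : set G :=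
  [set g | Gam g <> [set 0]].

Definition lie_automorphism (psi : {linear L -> L}) : Prop :=
  bijective psi /\ {morph psi : x y / lie x y}.

Definition equivalent (G H : groupType)
    (Gam : grading L G) (Gam' : grading L H) : Prop :=
  exists psi : {linear L -> L}, lie_automorphism psi /\
    forall g, Supp Gam g -> exists h : H, psi @` Gam g = Gam' h.

Definition realized_by (G : groupType) (Gam : grading L G)
    (H : groupType) : Prop :=
  exists Gam' : grading L H, equivalent Gam' Gam.

Definition abelian_grading (G : groupType) (Gam : grading L G) : Prop :=
  exists H : groupType, (forall x y : H, commute x y) /\ realized_by Gam H.

Definition coarsening (G H : groupType)
    (Gam : grading L G) (Gam' : grading L H) : Prop :=
  forall h, Supp Gam' h -> exists2 g, Supp Gam g & Gam' h `<=` Gam g.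

End GradingNotions.

(* Main.v *)
Require Import Defs.
From HB Require Import structures.
From mathcomp Require Import all_boot all_order all_algebra.
From mathcomp Require Import boolp classical_sets functions fsbigop.

Set Implicit Arguments.
Unset Strict Implicit.
Unset Printing Implicit Defensive.

Import GRing.Theory.

Local Open Scope classical_set_scope.
Local Open Scope ring_scope.

(** Only the passage from coarsenings to arbitrary gradings has content.  Let
    L be graded by a possibly noncommutative group G.  The idea is to exhibit
    the G-grading, up to its multiplication pattern, inside a coarsening of an
    abelian grading of another Lie algebra.

    Call monomial a right-normed bracket [x1, [x2, ... xn]] of homogeneous
    elements, of degrees g1, ..., gn.  The key fact is that the degrees of a
    nonzero monomial commute pairwise ([monomial_commute]).  For n = 2 this is
    antisymmetry: [x, y] = - [y, x] is homogeneous of degrees gh and hg.  In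
    general, x1 acts on [x2, ... xn] as a derivation, so that replacing some xi
    by [x1, xi] gives another nonzero monomial, of length n - 1
    ([monomial_absorb]), and one concludes by induction.

    Hence the degree of a nonzero monomial is the product of its gi in any
    order, and depends only on the multidegree, which counts the occurrences of
    each element of G and lives in the abelian group A of functions from G to
    the integers.  So the span
    V_a of the monomials of multidegree a lies in a single component L_(d a)
    ([weight_space_degree]).  The spaces V_a satisfy [V_a, V_b] <= V_(ab):
    therefore the finitely supported functions f : A -> L with values f a in
    V_a form a Lie algebra L' under convolution, the subalgebra of
    L (x) F[A] whose homogeneous components are the V_a.  It is graded by A,
    and grouping the elements of A with the same image under d yields a
    G-grading, which is a coarsening of the abelian one.

    The hypothesis applied to L' therefore makes this G-grading equivalent to
    an abelian one.  That property is about labels only: it means that the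
    support can be relabelled injectively in an abelian group, compatibly with
    the nonzero brackets of components ([abelian_labellingP]).  Each x in L_g
    has a copy in L', supported at the indicator function of g, and
    brackets of such copies are copies of brackets; so the same relabelling
    works for L. *)

(** * Bracket calculus *)

Section LieTheory.
Variables (F : fieldType) (L : lieAlgType F).
Implicit Types x y z : L.

Lemma lieDl x y z : lie (x + y) z = lie x z + lie y z.
Proof. by have := lie_linearl z 1 x y; rewrite !scale1r. Qed.

Lemma lieDr x y z : lie x (y + z) = lie x y + lie x z.
Proof. by have := lie_linearr x 1 y z; rewrite !scale1r. Qed.

Lemma lie0l x : lie 0 x = 0.
Proof. by apply: (addrI (lie 0 x)); rewrite -lieDl !addr0. Qed.

Lemma lie0r x : lie x 0 = 0.
Proof. by apply: (addrI (lie x 0)); rewrite -lieDr !addr0. Qed.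

Lemma lieZl a x y : lie (a *: x) y = a *: lie x y.
Proof. by have := lie_linearl y a x 0; rewrite lie0l !addr0. Qed.

Lemma lieZr a x y : lie x (a *: y) = a *: lie x y.
Proof. by have := lie_linearr x a y 0; rewrite lie0r !addr0. Qed.

Lemma lie_antisym x y : lie x y = - lie y x.
Proof.
apply/eqP; rewrite -addr_eq0; apply/eqP.
have := liexx (x + y).
by rewrite lieDl !lieDr !liexx add0r addr0.
Qed.

Lemma lieNr x y : lie x (- y) = - lie x y.
Proof. by rewrite -scaleN1r lieZr scaleN1r. Qed.

(** The Jacobi identity in the form used throughout: ad x is a derivation. *)
Lemma lie_derivation x y z : lie x (lie y z) = lie (lie x y) z + lie y (lie x z).
Proof.
have := lie_jacobi x y z.
rewrite (lie_antisym z x) lieNr (lie_antisym z (lie x y)) => /eqP.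
by rewrite -addrA -opprD subr_eq0 addrC => /eqP.
Qed.

Lemma lie_neq0l x y : lie x y <> 0 -> x <> 0.
Proof. by move=> xy0 x0; apply: xy0; rewrite x0 lie0l. Qed.

Lemma lie_neq0r x y : lie x y <> 0 -> y <> 0.
Proof. by move=> xy0 y0; apply: xy0; rewrite y0 lie0r. Qed.

HB.instance Definition _ x := GRing.isLinear.Build F L L *:%R (lie x) (lie_linearr x).

End LieTheory.

(** * Homogeneous components *)

Lemma sum_fibers (V : zmodType) (I J : eqType) (s : seq I) (c : I -> J)
    (f : I -> V) :
  \sum_(j <- undup (map c s)) \sum_(i <- s | c i == j) f i = \sum_(i <- s) f i.
Proof.
rewrite (exchange_big_dep predT) //= [RHS]big_seq [LHS]big_seq.
apply: eq_bigr => i si; rewrite big_mkcond.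
rewrite (bigD1_seq (c i)) ?undup_uniq ?mem_undup ?map_f //=.
by rewrite eqxx big1 ?addr0 // => j; rewrite eq_sym => /negPf ->.
Qed.

Section GradingTheory.
Variables (F : fieldType) (L : lieAlgType F).

Section Components.
Variables (G : groupType) (Gam : grading L G).
Implicit Types (g h : G) (x y : L).

Lemma component0 g : Gam g 0.
Proof. by have [] := component_submod Gam g; rewrite inE. Qed.

Lemma component_lin g a x y : Gam g x -> Gam g y -> Gam g (a *: x + y).
Proof.
move=> gx gy; have [_ /(_ a x y)] := component_submod Gam g.
by rewrite !inE; apply.
Qed.

Lemma componentD g x y : Gam g x -> Gam g y -> Gam g (x + y).
Proof. by move=> gx gy; rewrite -[x]scale1r; apply: component_lin. Qed.

Lemma componentZ g a x : Gam g x -> Gam g (a *: x).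
Proof. by move=> gx; rewrite -[_ *: _]addr0; apply/component_lin/component0. Qed.

Lemma componentN g x : Gam g x -> Gam g (- x).
Proof. by move=> gx; rewrite -scaleN1r; apply: componentZ. Qed.

Lemma component_sum g (I : Type) (s : seq I) (P : pred I) (f : I -> L) :
  (forall i, P i -> Gam g (f i)) -> Gam g (\sum_(i <- s | P i) f i).
Proof.
by move=> fP; elim/big_ind: _ => //; [exact: component0 | exact: componentD].
Qed.

Lemma SuppP g : Supp Gam g <-> exists2 x, Gam g x & x <> 0.
Proof.
split=> [g0|[x gx x0] g0]; last by move: gx; rewrite g0.
apply: contrapT => g'; apply: g0; apply/seteqP; split=> x /=; last first.
  by move=> ->; exact: component0.
by move=> gx; apply: contrapT => x0; apply: g'; exists x.
Qed.

(** In [component_direct] the summands have distinct degrees; here the degrees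
    [c i] may repeat, and the sum must then vanish degree by degree. *)
Lemma component_indep (I : eqType) (s : seq I) (c : I -> G) (f : I -> L) :
  (forall i, i \in s -> Gam (c i) (f i)) -> \sum_(i <- s) f i = 0 ->
  forall g, \sum_(i <- s | c i == g) f i = 0.
Proof.
move=> fP s0 g.
have f'P h : Gam h (\sum_(i <- s | c i == h) f i).
  rewrite big_seq_cond; by apply: component_sum => i /andP[/fP + /eqP <-].
have [gs|gs] := boolP (g \in undup (map c s)); last first.
  rewrite big_seq_cond big1 // => i /andP[si /eqP ig].
  by move: gs; rewrite mem_undup -ig map_f.
by apply: (component_direct (undup_uniq (map c s)) f'P) gs; rewrite sum_fibers.
Qed.

(** Write 0 = x - x with the two terms placed in degrees g and h. *)
Lemma component_uniq g h x : Gam g x -> Gam h x -> x <> 0 -> g = h.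
Proof.
move=> gx hx x0; apply: contrapT => gh; apply: x0.
have := @component_indep _ [:: true; false] (fun b => if b then g else h)
  (fun b : bool => if b then x else - x) _ _ g.
rewrite !big_cons !big_nil /= eqxx [h == g]eq_sym; case: eqP => // _.
rewrite !addr0; apply; last exact: subrr.
by move=> [] // _; apply: componentN.
Qed.

End Components.

(** Converts a decomposition with possibly repeated degrees into the form that
    [component_span] requires. *)
Lemma gather_span (G : groupType) (C : G -> set L) (I : eqType) (s : seq I)
    (c : I -> G) (f : I -> L) (x : L) :
  (forall g, submod_closed [in C g]) ->
  (forall i, i \in s -> C (c i) (f i)) -> x = \sum_(i <- s) f i ->
  exists (s' : seq G) (f' : G -> L),
    [/\ uniq s', forall g, C g (f' g) & x = \sum_(g <- s') f' g].
Proof.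
move=> Csub fP ->; exists (undup (map c s)), (fun g => \sum_(i <- s | c i == g) f i).
split; [exact: undup_uniq | move=> g | by rewrite sum_fibers].
have [C0 Clin] := Csub g.
rewrite big_seq_cond; elim/big_ind: _ => [|y z Cy Cz|i /andP[/fP + /eqP <-] //].
  by rewrite inE in C0.
by have := Clin 1 y z; rewrite !inE scale1r; apply.
Qed.

(** * Relabelling the support, and abelian gradings *)

Section Relabelling.
Variables (G H : groupType) (Gam : grading L G) (k : G -> H).

(** Exactly what is needed to rename degrees by k without changing the nonzero
    components. *)
Definition labelling : Prop :=
  (forall g h, Supp Gam g -> Supp Gam h -> k g = k h -> g = h) /\
  (forall g h x y, Gam g x -> Gam h y -> lie x y <> 0 -> k (g * h)%g = (k g * k h)%g).

Hypothesis kP : labelling.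

(** Injectivity of k on the support makes this set, the union of the [Gam g]
    with [k g = h], a single component or zero. *)
Definition relabel_component (h : H) : set L :=
  [set x | x = 0 \/ exists2 g, Gam g x & k g = h].

Let choose_label (h : H) x :
  relabel_component h x -> x <> 0 -> exists2 g, Gam g x & k g = h.
Proof. by case. Qed.

Lemma relabel_submod h : submod_closed [in relabel_component h].
Proof.
split=> [|a x y]; rewrite !inE; first by left.
move=> hx hy; have [-> |x0] := EM (x = 0); first by rewrite scaler0 add0r.
have [g gx kg] := choose_label hx x0.
have [-> |y0] := EM (y = 0).
  by rewrite addr0; right; exists g => //; apply: componentZ.
have [g' gy kg'] := choose_label hy y0.
have gg' : g = g'.
  by apply: kP.1; rewrite ?SuppP ?kg //; [exists x | exists y].
by right; exists g => //; apply: component_lin; rewrite // gg'.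
Qed.

Lemma relabel_span x : exists (s : seq H) (f : H -> L),
  [/\ uniq s, forall h, relabel_component h (f h) & x = \sum_(h <- s) f h].
Proof.
have [s [f [_ fP xE]]] := component_span Gam x.
apply: (gather_span (c := k) relabel_submod _ xE) => g _.
by right; exists g.
Qed.

Lemma relabel_direct (s : seq H) (f : H -> L) :
  uniq s -> (forall h, relabel_component h (f h)) -> \sum_(h <- s) f h = 0 ->
  forall h, h \in s -> f h = 0.
Proof.
move=> us fP s0.
have [c cP] : {c : H -> G & forall h, Gam (c h) (f h) /\ (f h <> 0 -> k (c h) = h)}.
  apply: (@choice _ _ (fun h g => Gam g (f h) /\ (f h <> 0 -> k g = h))) => h.
  have [f0|f0] := EM (f h = 0).
    by exists 1%g; split=> //; rewrite f0; apply: component0.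
  by have [g gx kg] := choose_label (fP h) f0; exists g.
move=> h hs; apply: contrapT => fh0; apply: (fh0).
have := component_indep (fun i _ => (cP i).1) s0 (c h).
rewrite big_mkcond (bigD1_seq h) //= eqxx big1 ?addr0 // => i ih.
case: eqP => // cih; apply/eqP; apply: contraNT ih => /eqP fi0.
by rewrite -((cP i).2 fi0) cih ((cP h).2 fh0).
Qed.

Lemma relabel_lie (h1 h2 : H) (x y : L) :
  relabel_component h1 x -> relabel_component h2 y ->
  relabel_component (h1 * h2)%g (lie x y).
Proof.
move=> h1x h2y; have [|xy0] := EM (lie x y = 0); first by left.
have [g gx <-] := choose_label h1x (lie_neq0l xy0).
have [g' gy <-] := choose_label h2y (lie_neq0r xy0).
right; exists (g * g')%g; first exact: component_lie.
exact: kP.2 gx gy xy0.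
Qed.

Definition relabel : grading L H :=
  Grading relabel_submod relabel_span relabel_direct relabel_lie.

Lemma relabelE g : Supp Gam g -> relabel (k g) = Gam g.
Proof.
move=> g0; apply/seteqP; split=> x /=; last by right; exists g.
move=> kx; have [-> |x0] := EM (x = 0); first exact: component0.
have [g' gx kg'] := choose_label kx x0.
suff <- : g' = g by [].
by apply: kP.1; rewrite // SuppP; exists x.
Qed.

End Relabelling.

Lemma equivalent_refl (G : groupType) (Gam : grading L G) : equivalent Gam Gam.
Proof.
exists idfun; split; first by split=> //; exists idfun.
by move=> g _; exists g; rewrite image_id.
Qed.

(** Equivalence is stated in one direction, from the support of the source.  It
    is onto the support of the target because psi is onto: an element of a
    missed component would be a sum of elements of the others. *)
Lemma component_in_image (G H : groupType) (Gam : grading L G)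
    (Gam' : grading L H) (psi : {linear L -> L}) :
  lie_automorphism psi ->
  (forall g, Supp Gam g -> exists h, psi @` Gam g = Gam' h) ->
  forall h, Supp Gam' h -> exists2 g, Supp Gam g & psi @` Gam g = Gam' h.
Proof.
move=> [[psi' psiK psiK'] _] psiP h /SuppP[y hy y0].
have [s [f [_ fP yE]]] := component_span Gam (psi' y).
have [c cP] : {c : G -> H & forall g, Supp Gam g -> psi @` Gam g = Gam' (c g)}.
  apply: (@choice _ _ (fun g h => Supp Gam g -> psi @` Gam g = Gam' h)) => g.
  by have [/psiP[h' ?]|?] := EM (Supp Gam g); [exists h' | exists 1%g].
apply: contrapT => noh; apply: y0.
(* [None] indexes y itself, [Some g] the opposite of the image of the part of
   degree g, so that the sum of the whole family vanishes. *)
pose c' o := if o is Some g then c g else h.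
pose f' o := if o is Some g then - psi (f g) else y.
have f'P o : Gam' (c' o) (f' o).
  case: o => [g|//] /=; have [f0|f0] := EM (f g = 0).
    by rewrite f0 linear0 oppr0; apply: component0.
  apply: componentN; rewrite -cP; first by exists (f g).
  by rewrite SuppP; exists (f g).
have := component_indep (s := None :: map Some s) (fun o _ => f'P o) _ h.
rewrite !big_cons /= eqxx !big_map /= sumrN -linear_sum -yE psiK' subrr.
move=> /(_ erefl); rewrite big1 ?addr0 // => g /eqP cg.
have [f0|f0] := EM (f g = 0); first by rewrite f0 linear0 oppr0.
have g0 : Supp Gam g by rewrite SuppP; exists (f g).
by case: noh; exists g => //; rewrite cP // cg.
Qed.

(** A group grading is equivalent to an abelian one as soon as its support can
    be renamed in an abelian group.  For the direct implication, an equivalence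
    to Gam' and one from a grading Gam3 by an abelian group match each nonzero
    component of Gam with one of Gam3, which defines the renaming. *)
Lemma abelian_labellingP (G : groupType) (Gam : grading L G) :
  (exists (H : groupType) (Gam' : grading L H),
      abelian_grading Gam' /\ equivalent Gam Gam') <->
  (exists (H : groupType) (k : G -> H),
      (forall x y : H, commute x y) /\ labelling Gam k).
Proof.
split; last first.
  move=> [H [k [Hab kP]]]; exists H, (relabel kP); split.
    by exists H; split=> //; exists (relabel kP); exact: equivalent_refl.
  exists idfun; split; first by split=> //; exists idfun.
  by move=> g g0; exists (k g); rewrite image_id relabelE.
move=> [K [Gam' [[H [Hab [Gam3 [phi [phiA phiP]]]]] [psi [psiA psiP]]]]].
have [[phi' phiK _] phiM] := phiA; have [[psi' psiK _] psiM] := psiA.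
have [k kP] : {k : G -> H & forall g, Supp Gam g -> psi @` Gam g = phi @` Gam3 (k g)}.
  apply: (@choice _ _ (fun g h => Supp Gam g -> psi @` Gam g = phi @` Gam3 h)) => g.
  have [g0|?] := EM (Supp Gam g); last by exists 1%g.
  have [a ga] := psiP g g0.
  have a0 : Supp Gam' a.
    have /SuppP[x gx x0] := g0; rewrite SuppP; exists (psi x).
      by rewrite -ga; exists x.
    by move=> px0; apply: x0; rewrite -[x]psiK px0 -[X in psi' X](linear0 psi) psiK.
  by have [h _ ha] := component_in_image phiA phiP a0; exists h => _; rewrite ga ha.
have lift g x : Gam g x -> x <> 0 -> exists2 z, Gam3 (k g) z & phi z = psi x.
  move=> gx x0; have g0 : Supp Gam g by rewrite SuppP; exists x.
  have : (psi @` Gam g) (psi x) by exists x.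
  by rewrite kP.
exists H, k; split=> //; split=> [g h g0 h0 kgh|g h x y gx hy xy0].
  have /SuppP[x gx x0] := g0.
  apply: (component_uniq gx) x0.
  have : (psi @` Gam g) (psi x) by exists x.
  by rewrite kP // kgh -kP // => -[x' hx' /(can_inj psiK) <-].
have [x' kx x'E] := lift _ _ gx (lie_neq0l xy0).
have [y' ky y'E] := lift _ _ hy (lie_neq0r xy0).
have [z kz zE] := lift _ _ (component_lie gx hy) xy0.
have zE' : z = lie x' y' by apply: (can_inj phiK); rewrite zE psiM phiM x'E y'E.
apply: (component_uniq kz); first by rewrite zE'; exact: component_lie.
move=> z0; apply: xy0; apply: (can_inj psiK).
by rewrite -zE z0 !linear0.
Qed.

End GradingTheory.

(** * The Lie algebra of finitely supported families *)

(** Degree-wise data of an A-graded Lie algebra, except that the spaces need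
    not be independent in L; commutativity of A is included because it is what
    makes the convolution bracket antisymmetric. *)
Record lie_family (F : fieldType) (L : lieAlgType F) (A : groupType) := LieFamily {
  fam :> A -> set L;
  fam_submod : forall a, submod_closed [in fam a];
  fam_comm : forall a b : A, commute a b;
  fam_lie : forall a b x y, fam a x -> fam b y -> fam (a * b)%g (lie x y)
}.

Section LoopAlgebra.
Variables (F : fieldType) (L : lieAlgType F) (A : groupType) (V : lie_family L A).
Implicit Types (a b : A) (x y : L).

Lemma fam0 a : V a 0.
Proof. by have [] := fam_submod V a; rewrite inE. Qed.

Lemma fam_lin a c x y : V a x -> V a y -> V a (c *: x + y).
Proof.
by move=> ax ay; have [_ /(_ c x y)] := fam_submod V a; rewrite !inE; apply.
Qed.

Lemma famD a x y : V a x -> V a y -> V a (x + y).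
Proof. by move=> ax ay; rewrite -[x]scale1r; apply: fam_lin. Qed.

Definition covers (s : seq A) (f : A -> L) : Prop :=
  forall a, a \notin s -> f a = 0.

Definition loop_pred : pred (A -> L) :=
  fun f => `[< (forall a, V a (f a)) /\ exists s, covers s f >].

Lemma loop_pred_submod : submod_closed loop_pred.
Proof.
split=> [|c f g /asboolP[fV [s sf]] /asboolP[gV [t tg]]]; apply/asboolP; split.
- by move=> a; apply: fam0.
- by exists [::].
- by move=> a; apply: fam_lin.
- exists (s ++ t) => a; rewrite mem_cat negb_or => /andP[/sf fa /tg ga].
  by rewrite !fctE fa ga scaler0 addr0.
Qed.

HB.instance Definition _ :=
  GRing.isSubmodClosed.Build F (A -> L) loop_pred loop_pred_submod.

(** The direct sum of the spaces V a, seen inside the Lie algebra L (x) F[A]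
    (for A the infinite cyclic group and V constant, the usual loop algebra). *)
Record loop := Loop { loop_fun :> A -> L; loop_funP : loop_fun \in loop_pred }.

HB.instance Definition _ := [isSub for loop_fun].
HB.instance Definition _ := [Choice of loop by <:].
HB.instance Definition _ := [SubChoice_isSubLmodule of loop by <:].

Implicit Types f g : loop.

Lemma loop_fam f a : V a (f a).
Proof. by case: f => f /= /asboolP[]. Qed.

Lemma loop_covers f : exists s, covers s f.
Proof. by case: f => f /= /asboolP[]. Qed.

Lemma loopD f g a : (f + g) a = f a + g a.
Proof. by []. Qed.

Lemma loopN f a : (- f) a = - f a.
Proof. by []. Qed.

Lemma loopZ c f a : (c *: f) a = c *: f a.
Proof. by []. Qed.

Lemma loop0 a : (0 : loop) a = 0.
Proof. by []. Qed.

Lemma loop_sum (I : Type) (s : seq I) (u : I -> loop) a :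
  (\sum_(i <- s) u i) a = \sum_(i <- s) u i a.
Proof. by elim/big_rec2: _ => // i y1 y2 _ <-. Qed.

Lemma eq_loop f g : (forall a, f a = g a) -> f = g.
Proof. by move=> fg; apply/val_inj/funext. Qed.

(** The bracket of L extended to L (x) F[A]; only finitely many terms are
    nonzero as f has finite support. *)
Definition convolution f g (c : A) : L :=
  \sum_(a \in [set a | f a <> 0]) lie (f a) (g (a^-1 * c)%g).

(** The support of f can be replaced by any finite set that contains it: this
    is what allows two functions to be summed over a common set. *)
Lemma convolutionE s f g c : uniq s -> covers s f ->
  convolution f g c = \sum_(a <- s) lie (f a) (g (a^-1 * c)%g).
Proof.
move=> us sf; apply: fsbig_fwiden => // a /=.
  by move=> fa; apply/negPn/negP => /sf.
by move=> [_ /contrapT fa]; rewrite /= fa lie0l.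
Qed.

Lemma cover_uniq f : exists2 s, uniq s & covers s f.
Proof.
have [s sf] := loop_covers f; exists (undup s); first exact: undup_uniq.
by move=> a; rewrite mem_undup => /sf.
Qed.

Lemma convolution_loop f g : convolution f g \in loop_pred.
Proof.
have [s us sf] := cover_uniq f; have [t tg] := loop_covers g.
apply/asboolP; split=> [c|].
  rewrite (convolutionE _ _ us sf); elim/big_ind: _ => [|x y|a _].
  - exact: fam0.
  - exact: famD.
  - by rewrite -[c in V c](mulVKg a); apply: fam_lie; apply: loop_fam.
exists [seq (a * b)%g | a <- s, b <- t] => c cst.
rewrite (convolutionE _ _ us sf) big_seq big1 // => a sa.
rewrite tg ?lie0r //; apply: contra cst => tb.
by rewrite -[c](mulVKg a); apply: (allpairs_f (fun a b => a * b)%g sa tb).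
Qed.

Definition loop_lie f g : loop := Loop (convolution_loop f g).

Lemma loop_lieE s f g c : uniq s -> covers s f ->
  loop_lie f g c = \sum_(a <- s) lie (f a) (g (a^-1 * c)%g).
Proof. exact: convolutionE. Qed.

Lemma loop_lie_linearl g : linear (loop_lie ^~ g).
Proof.
move=> c f f'; apply: eq_loop => b.
have [s _ sf] := cover_uniq f; have [s' _ sf'] := cover_uniq f'.
have u := undup_uniq (s ++ s').
have cf : covers (undup (s ++ s')) f.
  by move=> a; rewrite mem_undup mem_cat negb_or => /andP[/sf].
have cf' : covers (undup (s ++ s')) f'.
  by move=> a; rewrite mem_undup mem_cat negb_or => /andP[_ /sf'].
have cff' : covers (undup (s ++ s')) (c *: f + f').
  by move=> a ss; rewrite loopD loopZ cf // cf' // scaler0 addr0.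
rewrite loopD loopZ (loop_lieE _ _ u cf) (loop_lieE _ _ u cf').
rewrite (loop_lieE _ _ u cff') scaler_sumr -big_split.
by apply: eq_bigr => a _; rewrite loopD loopZ lieDl lieZl.
Qed.

Lemma loop_lie_linearr f : linear (loop_lie f).
Proof.
move=> c g g'; apply: eq_loop => b.
have [s us sf] := cover_uniq f.
rewrite loopD loopZ !(loop_lieE _ _ us sf) scaler_sumr -big_split.
by apply: eq_bigr => a _; rewrite loopD loopZ lieDr lieZr.
Qed.

Lemma loop_lieDl f g h : loop_lie (f + g) h = loop_lie f h + loop_lie g h.
Proof. by have := loop_lie_linearl h 1 f g; rewrite !scale1r. Qed.

Lemma loop_lieDr f g h : loop_lie f (g + h) = loop_lie f g + loop_lie f h.
Proof. by have := loop_lie_linearr f 1 g h; rewrite !scale1r. Qed.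

Lemma loop_lie0l f : loop_lie 0 f = 0.
Proof. by apply: (addrI (loop_lie 0 f)); rewrite -loop_lieDl !addr0. Qed.

Lemma loop_lie0r f : loop_lie f 0 = 0.
Proof. by apply: (addrI (loop_lie f 0)); rewrite -loop_lieDr !addr0. Qed.

Lemma single_loop a x : V a x -> (fun b => if b == a then x else 0) \in loop_pred.
Proof.
move=> ax; apply/asboolP; split=> [b|].
  by case: eqP => [-> //|_]; apply: fam0.
by exists [:: a] => b; rewrite inE => /negPf ->.
Qed.

Definition single a x (ax : V a x) : loop := Loop (single_loop ax).

Lemma single_sum f s :
  uniq s -> covers s f -> f = \sum_(a <- s) single (loop_fam f a).
Proof.
move=> us sf; apply: eq_loop => b; rewrite loop_sum /=.
have [bs|bs] := boolP (b \in s).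
  rewrite (bigD1_seq b) //= eqxx big1 ?addr0 // => a.
  by rewrite eq_sym => /negPf ->.
rewrite sf // big_seq big1 // => a sa; case: eqP => // ba.
by rewrite ba sa in bs.
Qed.

(** Identities that are additive in each argument only need to be checked on
    functions concentrated at one point, where they reduce to identities of
    L. *)
Lemma loop_ind_single (P : loop -> Prop) :
  P 0 -> (forall f g, P f -> P g -> P (f + g)) ->
  (forall a x (ax : V a x), P (single ax)) -> forall f, P f.
Proof.
move=> P0 PD P1 f; have [s us sf] := cover_uniq f.
by rewrite (single_sum us sf); elim/big_ind: _.
Qed.

Lemma single_lie a b x y (ax : V a x) (b_y : V b y) :
  loop_lie (single ax) (single b_y) = single (fam_lie ax b_y).
Proof.
apply: eq_loop => c; rewrite (@loop_lieE [:: a]) //; last first.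
  by move=> b'; rewrite inE /= => /negPf ->.
rewrite big_seq1 /= eqxx -(can_eq (mulKg a)) mulVKg.
by case: eqP; rewrite ?lie0r.
Qed.

Lemma loop_lie_antisym f g : loop_lie f g = - loop_lie g f.
Proof.
elim/loop_ind_single: f => [|f f' IH IH'|a x ax].
- by rewrite loop_lie0l loop_lie0r oppr0.
- by rewrite loop_lieDl loop_lieDr opprD IH IH'.
elim/loop_ind_single: g => [|g g' IH IH'|b y b_y].
- by rewrite loop_lie0l loop_lie0r oppr0.
- by rewrite loop_lieDl loop_lieDr opprD IH IH'.
rewrite !single_lie; apply: eq_loop => c; rewrite loopN /=.
rewrite (fam_comm V a b : a * b = b * a)%g.
by case: eqP; rewrite ?oppr0 // lie_antisym.
Qed.

Lemma loop_liexx f : loop_lie f f = 0.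
Proof.
elim/loop_ind_single: f => [|f g ff gg|a x ax]; first exact: loop_lie0l.
- rewrite loop_lieDl !loop_lieDr ff gg add0r addr0.
  by rewrite [X in X + _]loop_lie_antisym addNr.
- by rewrite single_lie; apply: eq_loop => c /=; rewrite liexx if_same.
Qed.

Lemma loop_lie_jacobi f g h :
  loop_lie f (loop_lie g h) + loop_lie g (loop_lie h f) +
  loop_lie h (loop_lie f g) = 0.
Proof.
elim/loop_ind_single: f => [|f f' IH IH'|a x ax].
- by rewrite !(loop_lie0l, loop_lie0r) !addr0.
- rewrite !(loop_lieDl, loop_lieDr) [X in X + _]addrACA.
  by rewrite [LHS]addrACA IH IH' addr0.
elim/loop_ind_single: g => [|g g' IH IH'|b y b_y].
- by rewrite !(loop_lie0l, loop_lie0r) !addr0.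
- rewrite !(loop_lieDl, loop_lieDr) [X in X + _]addrACA.
  by rewrite [LHS]addrACA IH IH' addr0.
elim/loop_ind_single: h => [|h h' IH IH'|c z cz].
- by rewrite !(loop_lie0l, loop_lie0r) !addr0.
- rewrite !(loop_lieDl, loop_lieDr) [X in X + _]addrACA.
  by rewrite [LHS]addrACA IH IH' addr0.
rewrite !single_lie; apply: eq_loop => d; rewrite !loopD loop0 /=.
have -> : (b * (c * a) = a * (b * c))%g by rewrite mulgA (fam_comm V).
have -> : (c * (a * b) = a * (b * c))%g by rewrite (fam_comm V) mulgA.
by case: eqP; rewrite ?addr0 // lie_jacobi.
Qed.

HB.instance Definition _ := Lmodule_isLieAlgebra.Build F loop
  loop_lie_linearl loop_lie_linearr loop_liexx loop_lie_jacobi.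

(** A map d : A -> H that is multiplicative on the degrees of nonzero brackets
    groups the points of A into the components of an H-grading.  The identity
    of A gives the grading by A itself. *)
Section LoopGrading.
Variables (H : groupType) (d : A -> H).
Hypothesis dP : forall a b x y,
  V a x -> V b y -> lie x y <> 0 -> d (a * b)%g = (d a * d b)%g.

Definition loop_component (h : H) : set loop :=
  [set f | forall a, f a <> 0 -> d a = h].

Lemma loop_component_submod h : submod_closed [in loop_component h].
Proof.
split=> [|c f g]; rewrite !inE; first by move=> a /(_ erefl).
move=> hf hg a; rewrite loopD loopZ => fg0; apply: contrapT => da.
have fa : f a = 0 by apply: contrapT => /hf.
have ga : g a = 0 by apply: contrapT => /hg.
by apply: fg0; rewrite fa ga scaler0 addr0.
Qed.

Lemma single_component a x (ax : V a x) : loop_component (d a) (single ax).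
Proof. by move=> b /=; case: eqP => [-> //|_ /(_ erefl)]. Qed.

Lemma loop_component_span f : exists (s : seq H) (u : H -> loop),
  [/\ uniq s, forall h, loop_component h (u h) & f = \sum_(h <- s) u h].
Proof.
have [s us sf] := cover_uniq f.
apply: (gather_span loop_component_submod _ (single_sum us sf)) => a _.
exact: single_component.
Qed.

Lemma loop_component_direct (s : seq H) (u : H -> loop) :
  uniq s -> (forall h, loop_component h (u h)) -> \sum_(h <- s) u h = 0 ->
  forall h, h \in s -> u h = 0.
Proof.
move=> us uP s0 h hs; apply: eq_loop => a; apply: contrapT => uh.
have /(congr1 (fun f : loop => f a)) := s0.
rewrite loop_sum (bigD1_seq h) //= big1 ?addr0 // => h' h'h.
by apply: contrapT => /uP dh'; move: h'h; rewrite -dh' (uP _ _ uh) eqxx.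
Qed.

Lemma loop_component_lie (h h' : H) (f g : loop) :
  loop_component h f -> loop_component h' g ->
  loop_component (h * h')%g (lie f g).
Proof.
move=> hf hg c fg; have [s us sf] := cover_uniq f.
apply: contrapT => dc; apply: fg.
rewrite [LHS](loop_lieE _ _ us sf) big1 // => a _; apply: contrapT => fg.
apply: dc; rewrite -(hf a (lie_neq0l fg)) -(hg _ (lie_neq0r fg)).
by rewrite -[c in LHS](mulVKg a) (dP (loop_fam f a) (loop_fam g _) fg).
Qed.

Definition loop_grading : grading loop H :=
  Grading loop_component_submod loop_component_span loop_component_direct
    loop_component_lie.

End LoopGrading.

End LoopAlgebra.

(** * Multidegrees *)

Lemma prod_commute (G : groupType) (g : G) (s : seq G) :
  (forall h, h \in s -> commute g h) -> commute g (\prod_(h <- s) h)%g.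
Proof.
move=> gs; rewrite big_seq; elim/big_ind: _ => //; first exact: commute1.
by move=> x y gx gy; apply: commuteM.
Qed.

Lemma perm_prodg (G : groupType) (s t : seq G) :
  {in s &, forall g h, commute g h} -> perm_eq s t ->
  (\prod_(g <- s) g = \prod_(g <- t) g)%g.
Proof.
elim: s t => [|g s IH] t sC st; first by move: st; rewrite perm_sym => /perm_nilP ->.
have gt : g \in t by rewrite -(perm_mem st) mem_head.
case/splitPr: gt st => t1 t2 st.
have {}st' : perm_eq s (t1 ++ t2).
  by rewrite -(perm_cons g) (perm_trans st) // perm_catC /= perm_cons perm_catC.
rewrite big_cons (IH (t1 ++ t2)) //; last first.
  by move=> x y xs ys; apply: sC; rewrite inE ?xs ?ys orbT.
rewrite !big_cat /= big_cons !mulgA; congr (_ * _)%g.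
apply: prod_commute => h ht1; apply: sC; first exact: mem_head.
by rewrite (perm_mem st) mem_cat ht1.
Qed.

(** The functions of finite support form the free abelian group on T; the full
    group of functions serves as well to tell finite multisets apart. *)
Definition int_fun (T : Type) : Type := T -> int.

Section IntFun.
Variable T : Type.
Let mul (u v : int_fun T) : int_fun T := (u : T -> int) + v.
Let one : int_fun T := (0 : T -> int).
Let inv (u : int_fun T) : int_fun T := - (u : T -> int).

HB.instance Definition _ := Choice.copy (int_fun T) (T -> int).
HB.instance Definition _ := isGroup.Build (int_fun T)
  (mul := mul) (one := one) (inv := inv)
  (@addrA (T -> int)) (@add0r _) (@addr0 _) (@addNr _) (@addrN _).

Lemma int_funC (u v : int_fun T) : commute u v.
Proof. exact: (@addrC (T -> int)). Qed.

End IntFun.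

Definition multidegree (T : eqType) (s : seq T) : int_fun T :=
  fun t => (count_mem t s)%:Z.

Lemma multidegree_cat (T : eqType) (s t : seq T) :
  multidegree (s ++ t) = (multidegree s * multidegree t)%g.
Proof. by apply/funext => g; rewrite /multidegree count_cat PoszD. Qed.

Lemma multidegree_inj (T : eqType) (s t : seq T) :
  multidegree s = multidegree t -> perm_eq s t.
Proof.
by move=> st; apply/allP => g _ /=; have := congr1 (@^~ g) st; case=> ->.
Qed.

(** * Monomials of homogeneous elements *)

Section Monomials.
Variables (F : fieldType) (L : lieAlgType F) (G : groupType) (Gam : grading L G).

Inductive monomial : seq G -> L -> Prop :=
| monomial1 g x : Gam g x -> monomial [:: g] x
| monomialS g x s y : Gam g x -> monomial s y -> monomial (g :: s) (lie x y).

Lemma monomial_component s x : monomial s x -> Gam (\prod_(g <- s) g)%g x.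
Proof.
elim=> [g {}x gx|g {}x {}s y gx _ IH]; first by rewrite big_seq1.
by rewrite big_cons; apply: component_lie.
Qed.

(** [x, y] and its opposite [y, x] have degrees gh and hg. *)
Lemma lie_commute g h x y :
  Gam g x -> Gam h y -> lie x y <> 0 -> commute g h.
Proof.
move=> gx hy xy0; apply: component_uniq (component_lie gx hy) _ xy0.
by rewrite lie_antisym; apply/componentN/component_lie.
Qed.

(** Expand [a, y] by the derivation rule: a nonzero bracket has a nonzero term,
    in which a acts on a single factor, of degree h say.  Such a term is again
    a monomial of the length of y, and g and h commute since a has a nonzero
    bracket with that factor.  The linear map T, which accumulates the outer
    factors along the induction, records that the term is nonzero after they
    are applied. *)
Lemma monomial_absorb (g : G) (a : L) s y (T : {linear L -> L}) :
  Gam g a -> monomial s y -> T (lie a y) <> 0 ->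
  exists s1 h s2 z, [/\ s = s1 ++ h :: s2, commute g h,
    monomial (s1 ++ (g * h)%g :: s2) z & T z <> 0].
Proof.
move=> ga sy; elim: sy T => [h {}y hy|h b {}s {}y hb sy IH] T Tay0.
  exists [::], h, [::], (lie a y); split=> //; last exact/monomial1/component_lie.
  by apply: lie_commute ga hy _ => ay0; apply: Tay0; rewrite ay0 linear0.
have [Taby0|Taby0] := EM (T (lie (lie a b) y) = 0); last first.
  exists [::], h, s, (lie (lie a b) y); split=> //.
    apply: lie_commute ga hb _ => ab0; apply: Taby0.
    by rewrite ab0 lie0l linear0.
  by apply: monomialS => //; apply: component_lie.
move: Tay0; rewrite lie_derivation linearD Taby0 add0r.
move=> /(IH (T \o lie b)) [s1 [h' [s2 [z [-> gh' s12z Tz0]]]]].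
by exists (h :: s1), h', s2, (lie b z); split=> //; apply: monomialS.
Qed.

(** Strong induction on the length, for [x, y] with y a monomial.  Some h in s
    commutes with g and can be replaced by g h in a nonzero monomial of the same
    length as y.  By induction h commutes with s, and g h with the rest of s;
    hence so does g = (g h) h^-1. *)
Lemma monomial_commute s x : monomial s x -> x <> 0 ->
  {in s &, forall g h, commute g h}.
Proof.
have [n] := ubnP (size s); elim: n s x => // n IH s x.
rewrite ltnS => sn sx; case: sx sn => [g {}x _ _ _ u v|g {}x {}s y gx sy sn xy0].
  by rewrite !inE => /eqP -> /eqP ->.
have sC := IH _ _ sn sy (lie_neq0r xy0).
have [s1 [h [s2 [z [sE gh s12z z0]]]]] := monomial_absorb (T := idfun) gx sy xy0.
have s'C : {in s1 ++ (g * h)%g :: s2 &, forall u v, commute u v}.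
  by apply: IH s12z z0; apply: leq_trans sn; rewrite /= sE !size_cat.
have gC v : v \in s -> commute g v.
  move=> vs; have hv : commute h v.
    by apply: sC vs; rewrite sE mem_cat mem_head orbT.
  have [-> //|vh] := eqVneq v h.
  have ghv : commute (g * h)%g v.
    apply: s'C; rewrite mem_cat inE ?eqxx ?orbT //.
    by move: vs; rewrite sE mem_cat inE (negPf vh) /= => /orP[->|->]; rewrite ?orbT.
  rewrite -[g](mulgK h); apply: commute_sym; apply: commuteM.
    exact: commute_sym.
  by apply: commuteV; apply: commute_sym.
move=> u v; rewrite !inE => /orP[/eqP ->|us] /orP[/eqP ->|vs] //.
- exact: gC.
- exact/commute_sym/gC.
- exact: sC.
Qed.

(** The span of the monomials of multidegree a, generated one monomial at a
    time so that membership can be eliminated by induction. *)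
Inductive weight_space (a : int_fun G) : L -> Prop :=
| weight_space0 : weight_space a 0
| weight_space_lin c s x y : multidegree s = a -> monomial s x ->
    weight_space a y -> weight_space a (c *: x + y).

Lemma weight_space_monomial s x : monomial s x -> weight_space (multidegree s) x.
Proof.
move=> sx; rewrite -[x]addr0 -[x]scale1r.
by apply: weight_space_lin sx _ => //; exact: weight_space0.
Qed.

Lemma weight_space_closed a c x y :
  weight_space a x -> weight_space a y -> weight_space a (c *: x + y).
Proof.
move=> ax ay; elim: ax => [|c' s x' x'' sa sx' _ IH].
  by rewrite scaler0 add0r.
by rewrite scalerDr scalerA -addrA; apply: weight_space_lin sx' IH.
Qed.

Lemma weight_space_submod a : submod_closed [in (weight_space a : set L)].
Proof.
split=> [|c x y]; rewrite !inE; first exact: weight_space0.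
exact: weight_space_closed.
Qed.

Lemma weight_space_lie1 g a x y : Gam g x -> weight_space a y ->
  weight_space (multidegree [:: g] * a)%g (lie x y).
Proof.
move=> gx; elim=> [|c s y' y'' sa sy' _ IH].
  by rewrite lie0r; apply: weight_space0.
rewrite lieDr lieZr; apply: weight_space_lin (monomialS gx sy') IH.
by rewrite -cat1s multidegree_cat sa.
Qed.

(** Right-normed monomials span a subalgebra: [[b, x], y] is the difference
    [b, [x, y]] - [x, [b, y]], and [b, y] is again a monomial, so induction on
    the left factor applies. *)
Lemma monomial_lie s t x y : monomial s x -> monomial t y ->
  weight_space (multidegree s * multidegree t)%g (lie x y).
Proof.
move=> sx; elim: sx t y => [g {}x gx|g b {}s {}x gb _ IH] t y ty.
  by apply: weight_space_lie1 => //; apply: weight_space_monomial.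
have -> : lie (lie b x) y = (- 1) *: lie x (lie b y) + lie b (lie x y).
  by rewrite (lie_derivation b) scaleN1r [RHS]addrC addrK.
rewrite -cat1s multidegree_cat.
apply: weight_space_closed; last first.
  by rewrite -mulgA; apply: weight_space_lie1 => //; apply: IH.
rewrite (int_funC (multidegree [:: g])) -mulgA -multidegree_cat.
exact: IH (monomialS gb ty).
Qed.

Lemma weight_space_lie a b x y : weight_space a x -> weight_space b y ->
  weight_space (a * b)%g (lie x y).
Proof.
move=> ax b_y; elim: ax => [|c s x' x'' sa sx' _ IH].
  by rewrite lie0l; apply: weight_space0.
rewrite lieDl lieZl; apply: weight_space_closed IH.
elim: b_y => [|c' t y' y'' tb ty' _ IH]; first by rewrite lie0r; apply: weight_space0.
rewrite lieDr lieZr; apply: weight_space_closed IH.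
by rewrite -sa -tb; apply: monomial_lie.
Qed.

(** Nonzero monomials of the same multidegree are permutations of each other, as
    words in G, and their letters commute: their degrees in G agree. *)
Lemma weight_space_degree a : exists g, forall x, weight_space a x -> Gam g x.
Proof.
have [[s [x [sa sx x0]]]|no] :=
    EM (exists s x, [/\ multidegree s = a, monomial s x & x <> 0]).
  exists (\prod_(g <- s) g)%g => y; elim=> [|c t y' y'' ta ty' _ IH].
    exact: component0.
  have [-> |y'0] := EM (y' = 0); first by rewrite scaler0 add0r.
  apply: component_lin IH; rewrite -(perm_prodg (monomial_commute ty' y'0)).
    exact: monomial_component.
  by apply: multidegree_inj; rewrite sa.
exists 1%g => y; elim=> [|c t y' y'' ta ty' _ IH]; first exact: component0.
have [-> |y'0] := EM (y' = 0); first by rewrite scaler0 add0r.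
by case: no; exists t, y'.
Qed.

Definition weight_family : lie_family L (int_fun G) :=
  LieFamily weight_space_submod (@int_funC G) weight_space_lie.

End Monomials.

(** * Coarsenings suffice *)

Theorem corollary41 (F : fieldType) :
  (forall (L : lieAlgType F) (G : groupType) (Gam : grading L G),
      exists (H : groupType) (Gam' : grading L H),
        abelian_grading Gam' /\ equivalent Gam Gam')
  <->
  (forall (L : lieAlgType F) (H : groupType) (Gam' : grading L H),
      abelian_grading Gam' ->
      forall (G : groupType) (Gam : grading L G),
        coarsening Gam Gam' ->
        exists (K : groupType) (Gam'' : grading L K),
          abelian_grading Gam'' /\ equivalent Gam Gam'').
Proof.
split=> [all_ab L H Gam' _ G Gam _|coarse_ab L G Gam]; first exact: all_ab.
pose V := weight_family Gam.
have [d dP] := choice (weight_space_degree Gam).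
have dM a b x y : V a x -> V b y -> lie x y <> 0 -> d (a * b)%g = (d a * d b)%g.
  move=> ax b_y xy0; apply: component_uniq xy0.
    exact/dP/(fam_lie ax b_y).
  by apply: component_lie; apply: dP.
pose GamA := loop_grading (V := V) (d := id) (fun _ _ _ _ _ _ _ => erefl).
pose GamG := loop_grading dM.
have GamA_abelian : abelian_grading GamA.
  exists (int_fun G); split; first exact: int_funC.
  by exists GamA; exact: equivalent_refl.
have GamG_coarse : coarsening GamG GamA.
  move=> a a0; have aG : GamA a `<=` GamG (d a) by move=> f af b /af /= ->.
  exists (d a) => //; have /SuppP[f af f0] := a0.
  by apply/SuppP; exists f => //; apply: aG.
have /abelian_labellingP [H [k [Hab [k_inj kM]]]] := coarse_ab _ _ _ GamA_abelian _ _ GamG_coarse.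
apply/abelian_labellingP; exists H, k; split=> //.
(* The copy of x in degree g of L is the function concentrated at e g. *)
pose e g : int_fun G := multidegree [:: g].
have eV g x : Gam g x -> V (e g) x.
  by move=> gx; apply: weight_space_monomial; apply: monomial1.
have de g x : Gam g x -> x <> 0 -> d (e g) = g.
  by move=> gx; apply: component_uniq (dP _ _ (eV _ _ gx)) gx.
have GamG_single g x (gx : Gam g x) : x <> 0 -> GamG g (single (eV g x gx)).
  by move=> x0; have := @single_component _ _ _ _ _ d _ _ (eV g x gx); rewrite (de g x).
have single_neq0 a x (ax : V a x) : x <> 0 -> single ax <> 0.
  by move=> x0 /(congr1 (fun f : loop V => f a)) /=; rewrite eqxx.
have Supp_GamG g : Supp Gam g -> Supp GamG g.
  move=> /SuppP[x gx x0]; apply/SuppP.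
  by exists (single (eV g x gx)); [apply: GamG_single|apply: single_neq0].
split=> [g h /Supp_GamG g0 /Supp_GamG h0|g h x y gx hy xy0]; first exact: k_inj.
have x0 := lie_neq0l xy0; have y0 := lie_neq0r xy0.
apply: kM (GamG_single _ _ gx x0) (GamG_single _ _ hy y0) _.
by rewrite [lie _ _]single_lie; apply: single_neq0.
Qed.
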